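(* Let $k\in\mathbb{N}$ and $m\in\mathbb{N}$ both be even, and let $h_1,\ldots,h_m\in\mathbb{Z}$ with $h_1$ odd and $\gcd(h_j,k)=1$ for $1\le j\le m$. For each $j$ let $h_j'$ satisfy $h_jh_j'\equiv 1\pmod k$. Define $$A(h_1,\ldots,h_m;k):=\sum_{\substack{a_1,\ldots,a_m \ (\mathrm{mod}\ k)\\ a_1+\cdots+a_m\equiv 0\ (\mathrm{mod}\ k)}} (-1)^{a_1}\left(\left(\frac{a_1h_1}{k}\right)\right)\cdots\left(\left(\frac{a_mh_m}{k}\right)\right).$$ Then $$A(h_1,\ldots,h_m;k)=\frac{(-1)^{m/2-1}}{2^mk}\sum_{\substack{1\le a\le k-1\\ a\ne k/2}}\tan\left(\frac{\pi a h_1'}{k}\right)\cot\left(\frac{\pi a h_2'}{k}\right)\cdots\cot\left(\frac{\pi a h_m'}{k}\right).$$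
   Context: For real $x$, $((x)):=\{x\}-\tfrac12$ if $x\notin\mathbb{Z}$ and $((x)):=0$ if $x\in\mathbb{Z}$, where $\{x\}=x-\lfloor x\rfloor$ is the fractional part. A sum over ''$a_1,\ldots,a_m\ (\mathrm{mod}\ k)$'' with a congruence condition means a sum over all $m$-tuples of residues modulo $k$ satisfying that condition (the summand is independent of the choice of representatives since $k$ is even). *)

(* Defs.v *)
From HB Require Import structures.
From mathcomp Require Import all_boot all_order all_algebra.
From mathcomp Require Import reals trigo.

Set Implicit Arguments.
Unset Strict Implicit.
Unset Printing Implicit Defensive.

Import Order.TTheory GRing.Theory Num.Theory.
Local Open Scope ring_scope.

Definition fracpart (R : realType) (x : R) : R := x - (Num.floor x)%:~R.

Definition sawtooth (R : realType) (x : R) : R :=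
  if x \is a Num.int then 0 else fracpart x - 2^-1.

Definition cot (R : realType) (x : R) : R := cos x / sin x.

(* The m-tuples of residues modulo k are represented by their entries in
   {0, ..., k - 1}.  Indices are shifted by one: the distinguished first index
   is Ordinal m_gt0, the element 0 of 'I_m. *)
Definition altsum (R : realType) (m : nat) (m_gt0 : (0 < m)%N)
    (h : 'I_m -> int) (k : nat) : R :=
  \sum_(a : {ffun 'I_m -> 'I_k} | (\sum_(j < m) a j == 0 %[mod k])%N)
    (-1) ^+ a (Ordinal m_gt0) *
    \prod_(j < m) sawtooth ((a j)%:R * (h j)%:~R / k%:R).

(* Main.v *)
(* With w = exp(2 pi i / k), the congruence on the a_j is detected by averaging
   over the k-th roots of unity w^n, so k A is the sum over n of the product
   over j of the discrete Fourier transforms of a |-> ((a h_j / k)).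
   Substituting a = x h_j' reduces each of them to the transform of ((x / k)),
   which at a k-th root of unity u <> 1 is (u + 1) / (2 (u - 1)), i.e.
   - (i / 2) cot t for u = exp(2 i t).  The factor (-1)^(a_1) multiplies the
   first root of unity by -1, shifting t by pi / 2 and giving (i / 2) tan t;
   that factor vanishes at n = k / 2, where u = 1. *)
Require Import Defs.
From HB Require Import structures.
From mathcomp Require Import all_boot all_order all_algebra.
From mathcomp Require Import ring lra complex.
From mathcomp Require Import reals trigo.

Import Order.TTheory GRing.Theory Num.Theory.
Local Open Scope ring_scope.
Local Open Scope complex_scope.

(** * Sums over residues modulo k *)

Lemma eq_modz_add (k x y : int) :
  (x = y %[mod k])%Z -> exists q, x = y + q * k.
Proof.
move/eqP; rewrite eqz_mod_dvd => /dvdzP[q e]; exists q.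
by rewrite -e addrC subrK.
Qed.

(** Multiplication by h' permutes the residues modulo k, its inverse being multiplication by h. *)
Lemma sum_ord_mulz (V : nmodType) (k : nat) (h h' : int) (f : int -> V) :
  (0 < k)%N -> (h * h' = 1 %[mod k%:Z])%Z ->
  (forall x y : int, (x = y %[mod k%:Z])%Z -> f x = f y) ->
  \sum_(a < k) f a%:Z = \sum_(x < k) f (x%:Z * h').
Proof.
case: k => [//|k] _ hh' fP.
pose mulmod (g : int) (x : 'I_k.+1) : 'I_k.+1 :=
  inord `|((x%:Z * g) %% k.+1%:Z)%Z|%N.
have mulmodE g x : (mulmod g x)%:Z = ((x%:Z * g) %% k.+1%:Z)%Z.
  have ge0 : 0 <= ((x%:Z * g) %% k.+1%:Z)%Z by exact: modz_ge0.
  rewrite inordK ?gez0_abs //.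
  by rewrite -ltz_nat gez0_abs // ltz_pmod.
have mulmodK g g' : (g * g' = 1 %[mod k.+1%:Z])%Z ->
    cancel (mulmod g) (mulmod g').
  move=> gg' x; apply/val_inj/eqP; rewrite -eqz_nat /= !mulmodE.
  rewrite modzMml -mulrA -modzMmr gg' modzMmr mulr1.
  by rewrite modz_small // ltz_nat ltn_ord.
rewrite (reindex (mulmod h')); last first.
  by apply/onW_bij; exists (mulmod h); apply: mulmodK; rewrite // mulrC.
by apply: eq_bigr => x _; apply: fP; rewrite mulmodE modz_mod.
Qed.

(** * Sums over powers of a root of unity *)

Section GeometricSums.
Variable F : fieldType.
Implicit Type z : F.

Lemma sum_expr_root1 (k : nat) z :
  z ^+ k = 1 -> \sum_(x < k) z ^+ x = if z == 1 then k%:R else 0.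
Proof.
move=> zk; case: eqP => [-> | /eqP z1].
  by under eq_bigr do rewrite expr1n; rewrite sumr_const card_ord.
apply: (mulfI (_ : z - 1 != 0)); first by rewrite subr_eq0.
by rewrite -subrX1 zk subrr mulr0.
Qed.

(** Telescoping of (x+1) z^(x+1) - x z^x = (z-1) x z^x + z z^x. The division-free form needs no case
    split on z = 1. *)
Lemma sum_natr_expr (n : nat) z :
  (z - 1) * (\sum_(x < n) x%:R * z ^+ x) + z * (\sum_(x < n) z ^+ x) =
  n%:R * z ^+ n.
Proof.
elim: n => [|n IHn]; first by rewrite !big_ord0; ring.
rewrite !big_ord_recr /= !mulrDr addrACA IHn exprS -natr1; ring.
Qed.

Lemma root1_neq0 (k : nat) z : (0 < k)%N -> z ^+ k = 1 -> z != 0.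
Proof.
move=> k_gt0; apply: contra_eq_neq => ->.
by rewrite expr0n gtn_eqF // eq_sym oner_eq0.
Qed.

Lemma root1_exprz_mod (k : nat) z (x y : int) : (0 < k)%N -> z ^+ k = 1 ->
  (x = y %[mod k%:Z])%Z -> z ^ x = z ^ y.
Proof.
move=> k_gt0 zk /eq_modz_add[q ->]; have z0 := root1_neq0 _ _ k_gt0 zk.
by rewrite expfzDr // [q * _]mulrC -exprz_exp -exprnP zk exp1rz mulr1.
Qed.

Lemma root1_exprzK (k : nat) z (h h' : int) : (0 < k)%N -> z ^+ k = 1 ->
  (h * h' = 1 %[mod k%:Z])%Z -> (z ^ h') ^ h = z.
Proof.
move=> k_gt0 zk hh'.
by rewrite exprz_exp mulrC (root1_exprz_mod _ _ _ 1 k_gt0 zk).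
Qed.

End GeometricSums.

(** * The sawtooth at fractions with denominator k *)

Section Sawtooth.
Variable R : realType.

Lemma sawtoothD_int (x : R) (n : int) : sawtooth (x + n%:~R) = sawtooth x.
Proof.
rewrite /sawtooth /fracpart rpredDr ?intr_int //.
rewrite floorDrz ?intr_int // intrKfloor rmorphD /=.
by case: ifP => // _; ring.
Qed.

(** The last term corrects the linear formula at x = 0, where it would give -1/2 instead of 0. *)
Lemma sawtooth_natr_div (k x : nat) : (x < k)%N ->
  sawtooth (x%:R / k%:R : R) = x%:R / k%:R - 2^-1 + (x == 0)%N%:R / 2.
Proof.
move=> xk; have k0 : (0 : R) < k%:R by rewrite ltr0n (leq_ltn_trans _ xk).
have fl : Num.floor (x%:R / k%:R : R) = 0.
  apply: floor_def; rewrite add0r divr_ge0 ?ler0n //=.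
  by rewrite ltr_pdivrMr // mul1r ltr_nat.
rewrite /sawtooth /fracpart intrEfloor fl subr0 eq_sym mulf_eq0 invr_eq0.
rewrite (gt_eqF k0) orbF pnatr_eq0.
by case: eqP => [->|_]; rewrite /=; field; rewrite ?gt_eqF.
Qed.

End Sawtooth.

(** * The finite Fourier transform of the sawtooth *)

Section FourierTransform.
Variable R : realType.
Local Notation C := R[i].

Definition expi (t : R) : C := cos t +i* sin t.

Lemma expiD s t : expi (s + t) = expi s * expi t.
Proof.
rewrite /expi cosD sinD; apply/eqP; rewrite eq_complex /=.
by apply/andP; split; apply/eqP; ring.
Qed.

Lemma expi0 : expi 0 = 1.
Proof. by rewrite /expi cos0 sin0. Qed.

Lemma expi_neq0 t : expi t != 0.
Proof.
apply/eqP => e; have := expiD t (- t).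
by rewrite subrr expi0 e mul0r => /eqP; rewrite oner_eq0.
Qed.

Lemma expiX t n : expi t ^+ n = expi (t * n%:R).
Proof.
elim: n => [|n IHn]; first by rewrite mulr0 expi0.
by rewrite exprSr IHn -expiD -natr1 mulrDr mulr1.
Qed.

Lemma expiXz t (n : int) : expi t ^ n = expi (t * n%:~R).
Proof.
case: n => n; first by rewrite -exprnP expiX.
apply: (mulfI (expi_neq0 (t * n.+1%:R))).
rewrite NegzE -expiD rmorphN mulrN subrr expi0 -expiX.
by rewrite -exprnN divff // expf_neq0 ?expi_neq0.
Qed.

Lemma expi_pi : expi pi = -1.
Proof.
rewrite /expi cospi sinpi; apply/eqP.
by rewrite eq_complex /= oppr0 !eqxx.
Qed.

(** Half-angle factorization: pulling out e^(it) leaves e^(it) - e^(-it). *)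
Lemma expi2_sub1 t : expi (t *+ 2) - 1 = 2 * 'i * (sin t)%:C * expi t.
Proof.
rewrite mulr2n /expi cosD sinD; apply/eqP; rewrite eq_complex /=.
apply/andP; split; apply/eqP; last ring.
by ring: (cos2sin2 t).
Qed.

Lemma expi2_add1 t : expi (t *+ 2) + 1 = 2 * (cos t)%:C * expi t.
Proof.
rewrite mulr2n /expi cosD sinD; apply/eqP; rewrite eq_complex /=.
apply/andP; split; apply/eqP; last ring.
by ring: (cos2sin2 t).
Qed.

Lemma expi2_eq1 t : (expi (t *+ 2) == 1) = (sin t == 0).
Proof.
rewrite -subr_eq0 expi2_sub1 !mulf_eq0 (negPf (expi_neq0 t)) orbF.
by rewrite pnatr_eq0 (negPf (neq0Ci _)) -(inj_eq (@complexI R)).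
Qed.

Lemma cayley_expi t : sin t != 0 ->
  (expi (t *+ 2) + 1) / (2 * (expi (t *+ 2) - 1)) = - 'i / 2 * (cot t)%:C.
Proof.
move=> s0; rewrite expi2_add1 expi2_sub1 /cot fmorph_div /=.
have s0' : (sin t)%:C != 0 by rewrite -(inj_eq (@complexI R)) in s0.
have i2 : 'i * 'i = -1 :> C by rewrite -expr2 sqrCi.
have i0 : 'i%R != 0 :> C := neq0Ci _.
have E0 := expi_neq0 t.
(* Multiplying by i uses i^2 = -1 beforehand, so that [field] can treat i as a nonzero symbol. *)
apply: (mulfI i0); rewrite !mulrA mulrN i2 opprK.
by field; rewrite i0 s0' E0.
Qed.

(** The linear part, the constant -1/2 and the correction at 0 are summed separately. For z <> 1
    they give 1/(z-1), 0 and 1/2; for z = 1 they give (k-1)/2, -k/2 and 1/2, which cancel. *)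
Lemma sawtooth_dft (k : nat) (z : C) : (0 < k)%N -> z ^+ k = 1 ->
  \sum_(x < k) (sawtooth (x%:R / k%:R))%:C * z ^+ x =
  if z == 1 then 0 else (z + 1) / (2 * (z - 1)).
Proof.
move=> k_gt0 zk; have k0 : k%:R != 0 :> C by rewrite pnatr_eq0 -lt0n.
have -> : \sum_(x < k) (sawtooth (x%:R / k%:R))%:C * z ^+ x =
    (\sum_(x < k) x%:R * z ^+ x) / k%:R - (\sum_(x < k) z ^+ x) / 2 + 2^-1.
  transitivity (\sum_(x < k) (x%:R * z ^+ x / k%:R - z ^+ x / 2
      + (val x == 0)%N%:R / 2)).
    apply: eq_bigr => x _; rewrite sawtooth_natr_div // rmorphD rmorphB.
    rewrite !fmorph_div !rmorph_nat fmorphV rmorph_nat.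
    case: (val x =P 0%N) => [x0|_] /=; last by field.
    by rewrite x0 expr0; field.
  rewrite big_split sumrB -!mulr_suml /=; congr (_ + _).
  case: k k_gt0 {zk k0} => // k _.
  by rewrite big_ord_recl /= big1 ?addr0 ?mul1r.
rewrite sum_expr_root1 //; have := sum_natr_expr _ k z.
case: (eqVneq z 1) => [-> _|z1].
  have -> : \sum_(x < k) x%:R * 1 ^+ x = (k%:R * (k%:R - 1)) / 2 :> C.
    elim: k {k_gt0 zk k0} => [|k IHk]; first by rewrite big_ord0 !mul0r.
    by rewrite big_ord_recr /= IHk expr1n -natr1; field.
  by field.
have z1' : z - 1 != 0 by rewrite subr_eq0.
rewrite sum_expr_root1 // (negPf z1) zk mulr0 addr0 mulr1 => e.
by rewrite -[X in X / _](mulKf z1') e; field; rewrite k0 z1'.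
Qed.

Lemma sawtooth_dft_mul (k : nat) (h h' : int) (z : C) : (0 < k)%N ->
  (h * h' = 1 %[mod k%:Z])%Z -> z ^+ k = 1 ->
  \sum_(a < k) (sawtooth (a%:R * h%:~R / k%:R))%:C * z ^+ a =
  if z ^ h' == 1 then 0 else (z ^ h' + 1) / (2 * (z ^ h' - 1)).
Proof.
move=> k_gt0 hh' zk; have k0 : k%:R != 0 :> R by rewrite pnatr_eq0 -lt0n.
have sawP (x y q : int) : x = y + q * k%:Z ->
    sawtooth (x%:~R / k%:R) = sawtooth (y%:~R / k%:R) :> R.
  move=> ->; rewrite -(sawtoothD_int _ (y%:~R / _) q); congr sawtooth.
  by rewrite rmorphD rmorphM /=; field.
rewrite -(@sawtooth_dft k) //; last first.
  by rewrite exprnP exprzAC -exprnP zk exp1rz.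
pose f (x : int) := (sawtooth ((x * h)%:~R / k%:R))%:C * z ^ x.
transitivity (\sum_(a < k) f a%:Z).
  by apply: eq_bigr => a _; rewrite /f rmorphM.
rewrite (sum_ord_mulz _ _ h h') //; last first.
  move=> x y xy; rewrite /f (root1_exprz_mod _ _ _ _ _ k_gt0 zk xy).
  have [q ->] := eq_modz_add _ _ _ xy; congr (_%:C * _).
  by apply: (sawP _ _ (q * h)); ring.
(* Writing h h' = 1 + qk, the argument x h' h / k differs from x / k by the integer xq. *)
have [q e] := eq_modz_add _ _ _ hh'.
apply: eq_bigr => x _; rewrite /f; congr (_%:C * _).
  by apply: (sawP _ x%:Z (x%:Z * q)); rewrite -mulrA [h' * h]mulrC e; ring.
by rewrite mulrC -exprz_exp.
Qed.

(** The root of unity e^(2 pi i n/k), with the angle kept as a double so that the half-angle lemmas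
    apply directly. *)
Definition unity (k n : nat) : C := expi ((pi * n%:R / k%:R) *+ 2).

Lemma unityX k n p : unity k n ^+ p = unity k (n * p).
Proof. by rewrite /unity expiX natrM mulrnAl; congr expi; ring. Qed.

Lemma unityXz k n (h : int) :
  unity k n ^ h = expi ((pi * n%:R * h%:~R / k%:R) *+ 2).
Proof. by rewrite /unity expiXz; congr expi; rewrite mulrnAl; ring. Qed.

Lemma unityD k n p : unity k (n + p) = unity k n * unity k p.
Proof. by rewrite /unity -expiD natrD; congr expi; rewrite -mulrnDl; ring. Qed.

Lemma unity_sum k (I : finType) (a : I -> nat) :
  unity k (\sum_i a i) = \prod_i unity k (a i).
Proof.
apply: (big_morph (unity k)) => [x y|]; first exact: unityD.
by rewrite /unity mulr0 mul0r mul0rn expi0.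
Qed.

Lemma expi_2pi : expi (pi *+ 2) = 1.
Proof. by rewrite mulr2n expiD expi_pi mulrNN mulr1. Qed.

Lemma unity_root k n : (0 < k)%N -> unity k n ^+ k = 1.
Proof.
move=> k_gt0; have k0 : k%:R != 0 :> R by rewrite pnatr_eq0 -lt0n.
rewrite /unity expiX (_ : _ * k%:R = pi *+ 2 * n%:R); last by field.
by rewrite -expiX expi_2pi expr1n.
Qed.

(** Only r = n mod k matters, and for 0 < r < k the half-angle pi r/k lies in (0, pi), where the
    sine is positive. *)
Lemma unity_eq1 k n : (0 < k)%N -> (unity k n == 1) = (k %| n)%N.
Proof.
move=> k_gt0; have k0 : 0 < k%:R :> R by rewrite ltr0n.
rewrite {1}(divn_eq n k) mulnC unityD -unityX.
have -> : unity k k = 1 by rewrite /unity mulfK ?expi_2pi // lt0r_neq0.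
rewrite expr1n mul1r /unity expi2_eq1 /dvdn.
have [->|r0] := eqVneq (n %% k)%N 0%N; first by rewrite mulr0 mul0r sin0 eqxx.
apply/gt_eqF/sin_gt0_pi; rewrite -lt0n in r0.
rewrite divr_gt0 ?mulr_gt0 ?pi_gt0 ?ltr0n //=.
by rewrite ltr_pdivrMr // ltr_pM2l ?pi_gt0 // ltr_nat ltn_pmod.
Qed.

(** Orthogonality of characters: once the product of sums is expanded over the functions [a] and the
    summations are exchanged, the inner sum over n is k if k divides the sum of the [a j], and 0
    otherwise. *)
Lemma sum_unity_filter (m k : nat) (g : 'I_m -> 'I_k -> C) : (0 < k)%N ->
  k%:R * \sum_(a : {ffun 'I_m -> 'I_k} | (\sum_(j < m) a j == 0 %[mod k])%N)
           \prod_(j < m) g j (a j) =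
  \sum_(n < k) \prod_(j < m) \sum_(a < k) g j a * unity k n ^+ a.
Proof.
move=> k_gt0; under [RHS]eq_bigr do rewrite bigA_distr_bigA.
rewrite exchange_big /= big_mkcond mulr_sumr; apply: eq_bigr => a _.
transitivity (\sum_(n < k) (\prod_(j < m) g j (a j)) *
    unity k (\sum_(j < m) a j) ^+ n).
  rewrite -mulr_sumr sum_expr_root1 ?unity_root // unity_eq1 // mod0n.
  by rewrite -/(dvdn _ _); case: ifP => _; rewrite ?mulr0 // mulrC.
apply: eq_bigr => n _; rewrite unity_sum -prodrXl -big_split /=.
by apply: eq_bigr => j _; rewrite !unityX mulnC.
Qed.

Lemma sawtooth_dft_cot (k n : nat) (h h' : int) : (0 < n < k)%N ->
  (h * h' = 1 %[mod k%:Z])%Z ->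
  \sum_(a < k) (sawtooth (a%:R * h%:~R / k%:R))%:C * unity k n ^+ a =
  - 'i / 2 * (cot (pi * n%:R * h'%:~R / k%:R))%:C.
Proof.
case/andP=> n_gt0 nk hh'; have k_gt0 : (0 < k)%N by apply: leq_trans nk.
have zk := unity_root k n k_gt0.
rewrite (sawtooth_dft_mul _ _ h') //.
(* Raising to the power h would give [unity k n] = 1, impossible for 0 < n < k. *)
have : unity k n ^ h' != 1.
  apply/eqP => e; have := root1_exprzK _ _ _ _ _ k_gt0 zk hh'.
  by rewrite e exp1rz => /esym/eqP; rewrite unity_eq1 // gtnNdvd.
move=> u1; rewrite (negPf u1); move: u1.
by rewrite unityXz expi2_eq1 => /cayley_expi.
Qed.

Lemma sawtooth_dft_tan (k n : nat) (h h' : int) : ~~ odd k -> odd `|h|%N ->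
  (0 < n < k)%N -> (h * h' = 1 %[mod k%:Z])%Z ->
  \sum_(a < k) (sawtooth (a%:R * h%:~R / k%:R))%:C * (- unity k n) ^+ a =
  if n == k./2 then 0
  else 'i / 2 * (tan (pi * n%:R * h'%:~R / k%:R))%:C.
Proof.
move=> k_even h_odd /andP[n_gt0 nk] hh'.
have k_gt0 : (0 < k)%N by apply: leq_trans nk.
have k0 : k%:R != 0 :> R by rewrite pnatr_eq0 -lt0n.
have k2 : k%:R = k./2%:R *+ 2 :> R by rewrite -mulrnA muln2 even_halfK.
have k20 : k./2%:R != 0 :> R by move: k0; rewrite k2 mulrn_eq0.
have N1k : (-1) ^+ k = 1 :> C by rewrite -signr_odd (negPf k_even).
have zk : (- unity k n) ^+ k = 1.
  by rewrite -mulN1r exprMn N1k mul1r unity_root.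
have N1h : (-1) ^ h = -1 :> C.
  case: (intP h) h_odd => // p; rewrite ?abszN => /= p_odd.
    by rewrite -exprnP -signr_odd /= p_odd.
  by rewrite -exprnN -signr_odd /= p_odd invrN1.
(* As k is even, -1 is itself a k-th root of unity, so -1 = ((-1)^h')^h = ((-1)^h)^h' = (-1)^h'.
   Hence the sign survives the substitution by h'. *)
have N1h' : (-1) ^ h' = -1 :> C.
  by rewrite -{1}N1h exprzAC (root1_exprzK _ _ _ _ _ k_gt0 N1k hh').
rewrite (sawtooth_dft_mul _ _ h') //.
(* The sign is a rotation by pi, which turns the cotangent into a tangent. *)
have NE t : - expi (t *+ 2) = expi ((t + pi / 2) *+ 2).
  rewrite (_ : (t + pi / 2) *+ 2 = t *+ 2 + pi); last by field.
  by rewrite (expiD _ pi) expi_pi mulrN1.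
have uE : (- unity k n) ^ h' = expi ((pi * n%:R * h'%:~R / k%:R + pi / 2) *+ 2).
  by rewrite -mulN1r expfzMl N1h' mulN1r unityXz NE.
(* Raising to the power h reduces the left side to [- unity k n] = 1, that is cos(pi n/k) = 0; the
   cosine being injective on [0, pi], this forces n = k/2. *)
have u1 : ((- unity k n) ^ h' == 1) = (n == k./2).
  apply/eqP/eqP => [e|->].
    have := root1_exprzK _ _ _ _ _ k_gt0 zk hh'.
    rewrite e exp1rz => /esym/eqP; rewrite NE expi2_eq1 sinDpihalf => /eqP c0.
    have : pi * n%:R / k%:R = pi / 2 :> R.
      apply: cos_inj; rewrite ?c0 ?cos_pihalf // in_itv /=.
        rewrite divr_ge0 ?mulr_ge0 ?pi_ge0 ?ler0n //=.
        by rewrite ler_pdivrMr ?ltr0n // ler_pM2l ?pi_gt0 // ler_nat ltnW.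
      by have := pi_gt0 R; lra.
    move=> en; apply/eqP; rewrite -(eqr_nat R); apply/eqP.
    have pi0 : pi / k%:R != 0 :> R by rewrite gt_eqF // divr_gt0 ?pi_gt0 ?ltr0n.
    by apply: (mulfI pi0); rewrite mulrAC en k2; field.
  have -> : unity k k./2 = -1.
    rewrite /unity -expi_pi; congr expi.
    by rewrite k2; field.
  by rewrite opprK exp1rz.
rewrite u1; case: (n =P k./2) u1 => // _ /negbT; rewrite uE expi2_eq1 => s0.
rewrite (cayley_expi _ s0) !mulNr -mulrN -rmorphN.
by rewrite /cot /tan cosDpihalf sinDpihalf mulNr opprK.
Qed.

(** The sign is absorbed into [g] at the first index, then merged with the power of the root of
    unity. The exponent [j == Ordinal m_gt0] is 1 at that index and 0 elsewhere. *)
Lemma altsum_complex (m k : nat) (m_gt0 : (0 < m)%N) (h : 'I_m -> int) :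
  (0 < k)%N ->
  k%:R * (altsum R m_gt0 h k)%:C =
  \sum_(n < k) \prod_(j < m)
    \sum_(a < k) (sawtooth (a%:R * (h j)%:~R / k%:R))%:C *
      ((-1) ^+ (j == Ordinal m_gt0) * unity k n) ^+ a.
Proof.
move=> k_gt0.
pose g (j : 'I_m) (a : 'I_k) : C := (-1) ^+ ((j == Ordinal m_gt0) * a) *
  (sawtooth (a%:R * (h j)%:~R / k%:R))%:C.
transitivity (\sum_(n < k) \prod_(j < m) \sum_(a < k) g j a * unity k n ^+ a).
  rewrite -sum_unity_filter // /altsum rmorph_sum /=; congr (_ * _).
  apply: eq_bigr => a _; rewrite rmorphM rmorph_prod /= big_split /=.
  congr (_ * _); rewrite (bigD1 (Ordinal m_gt0)) // eqxx mul1n.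
  rewrite big1 => [|j /negPf ->]; last by rewrite mul0n.
  by rewrite rmorphXn rmorphN1 /= mulr1.
apply: eq_bigr => n _; apply: eq_bigr => j _; apply: eq_bigr => a _.
by rewrite /g exprMn -exprM mulrCA mulrA.
Qed.

End FourierTransform.

(** * Assembling the tangent and cotangent factors *)

Theorem theorem4 (R : realType) (k m : nat)
    (k_gt0 : (0 < k)%N) (m_gt0 : (0 < m)%N)
    (k_even : ~~ odd k) (m_even : ~~ odd m)
    (h h' : 'I_m -> int)
    (h1_odd : odd `|h (Ordinal m_gt0)|%N)
    (h_coprime : forall j : 'I_m, gcdz (h j) k%:Z = 1)
    (h'_inv : forall j : 'I_m, (h j * h' j = 1 %[mod k%:Z])%Z) :
  altsum R m_gt0 h k =
    (-1) ^+ (m./2 - 1)%N / (2 ^+ m * k%:R) *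
    \sum_(1 <= a < k | a != k./2)
      (tan (pi * a%:R * (h' (Ordinal m_gt0))%:~R / k%:R) *
       \prod_(j < m | j != Ordinal m_gt0)
          cot (pi * a%:R * (h' j)%:~R / k%:R)).
Proof.
have k0 : k%:R != 0 :> R[i] by rewrite pnatr_eq0 -lt0n.
(* A positive even m is at least 2; the second index supplies the factor that vanishes at n = 0. *)
have m_gt1 : (1 < m)%N.
  by case: m m_gt0 m_even {h h' h1_odd h_coprime h'_inv} => [|[]].
set j0 := Ordinal m_gt0; apply: (@complexI R); apply: (mulfI k0).
rewrite altsum_complex // -/j0.
pose term a : R := tan (pi * a%:R * (h' j0)%:~R / k%:R) *
  \prod_(j < m | j != j0) cot (pi * a%:R * (h' j)%:~R / k%:R).
(* One factor i/2 from the tangent and m-1 factors -i/2 from the cotangents multiply to -(-i/2)^m.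
   For m = 2p+2 this is -(-1/4)^(p+1) = (-1)^p / 2^m. *)
have cE : 'i / 2 * (- 'i / 2) ^+ m.-1 = (-1) ^+ (m./2 - 1) / 2 ^+ m :> R[i].
  have [p mE] : exists p, m = p.+1.*2.
    by exists (m./2 - 1)%N; rewrite subn1 prednK ?even_halfK // half_gt0.
  have c2 : (- 'i / 2) ^+ 2 = -1 / 2 ^+ 2 :> R[i].
    by rewrite expr_div_n sqrrN sqrCi.
  have -> : 'i / 2 * (- 'i / 2) ^+ m.-1 = - (- 'i / 2) ^+ m :> R[i].
    by rewrite -[in RHS](prednK m_gt0) exprS; ring.
  rewrite mE doubleK subn1 -mul2n !exprM c2 expr_div_n exprS.
  by rewrite mulN1r mulNr opprK.
transitivity (\sum_(1 <= a < k | a != k./2)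
    ((-1) ^+ (m./2 - 1) / 2 ^+ m) * (term a)%:C : R[i]).
  rewrite -(big_mkord xpredT (fun n => \prod_(j < m) \sum_(a < k)
    (sawtooth (a%:R * (h j)%:~R / k%:R))%:C *
    ((-1) ^+ (j == j0) * unity R k n) ^+ a)).
  (* At n = 0 the second factor is the plain sum of the sawtooth, which is 0. *)
  rewrite big_ltn // [X in X + _ = _](bigD1 (Ordinal m_gt1)) //=.
  rewrite (sawtooth_dft_mul R k _ _ _ k_gt0 (h'_inv _)); last first.
    by rewrite mul1r unity_root.
  rewrite mul1r unityXz !(mulr0, mul0r, mul0rn) expi0 eqxx mul0r add0r.
  (* The excluded index k/2 is restored as a zero term, to match the vanishing case of
     [sawtooth_dft_tan]. *)
  rewrite [RHS]big_mkcond /= !big_nat; apply: eq_bigr => n n_k.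
  rewrite (bigD1 j0) // eqxx expr1 mulN1r.
  rewrite (sawtooth_dft_tan R k n _ _ k_even h1_odd n_k (h'_inv _)).
  rewrite /=; case: eqP => _ /=; first by rewrite mul0r.
  rewrite (eq_bigr (fun j => - 'i / 2 *
      (cot (pi * n%:R * (h' j)%:~R / k%:R))%:C)); last first.
    move=> j /negPf ->; rewrite mul1r.
    by rewrite (sawtooth_dft_cot R k n _ _ n_k (h'_inv _)).
  rewrite big_split /= prodr_const cardC1 card_ord -cE.
  by rewrite -rmorph_prod /term [in RHS](rmorphM _ (tan _)) /=; ring.
rewrite -mulr_sumr !rmorphM rmorph_sum fmorphV !rmorphM !rmorphXn rmorphN1.
rewrite !rmorph_nat /=; field.
by rewrite k0 expf_neq0 ?pnatr_eq0.
Qed.
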